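(* Let $F\in K[x]$ be a monic irreducible polynomial, and let $\nu\in\mathcal V_F$, $\nu\neq\nu_0$, be a valuation that is not a maximal element of $(\mathcal V,\leq)$. For each homogeneous irreducible factor $\phi\in\mathcal G_\nu$ of $\mathrm{in}_\nu(F)$ write $\phi=u\cdot\mathrm{in}_\nu(Q)$ with $u\in\mathcal U_\nu$ and $Q\in\mathrm{KP}(\nu)$. Then there exist $\alpha_1\in\Gamma$ and $\mu\in\mathcal V_F$ such that $\nu(Q)<\alpha_1=\mu(Q)$ and, for every $\mu'\in\mathcal V_F$, $$\mu\leq\mu'\ \Longrightarrow\ \mu'(Q)=\alpha_1.$$
   Context: $(K,\nu_0)$ is a valued field with value group $\Gamma_0$, and $\Gamma$ is a fixed totally ordered divisible abelian group containing $\Gamma_0$; $\Gamma_\infty=\Gamma\cup\{\infty\}$ with the usual conventions. A valuation on a commutative unital ring $R$ (with values in $\Gamma_\infty$) is a map $\nu:R\to\Gamma_\infty$ with $\nu(ab)=\nu(a)+\nu(b)$, $\nu(a+b)\geq\min\{\nu(a),\nu(b)\}$, $\nu(1)=0$, $\nu(0)=\infty$; nonzero elements may have value $\infty$. Its support is $\mathrm{supp}(\nu)=\{a\in R\mid\nu(a)=\infty\}$. $\mathcal V=\{\nu_0\}\cup\{\nu:K[x]\to\Gamma_\infty\mid \nu\text{ is a valuation extending }\nu_0\}$, partially ordered by: $\nu_0\leq\nu$ for all $\nu\in\mathcal V$, and for $\nu,\mu\in\mathcal V\setminus\{\nu_0\}$, $\nu\leq\mu$ iff $\nu(f)\leq\mu(f)$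 for every $f\in K[x]$. For a monic irreducible $F\in K[x]$: $\mathcal V_{F_\infty}=\{\mu\in\mathcal V\mid\mathrm{supp}(\mu)=(F)\}$ and $\mathcal V_F=\{\nu\in\mathcal V\mid\nu\leq\mu\text{ for some }\mu\in\mathcal V_{F_\infty}\}$. For $\nu\in\mathcal V\setminus\{\nu_0\}$, the graded ring is $\mathcal G_\nu=\bigoplus_{\gamma\in\nu(K[x]),\,\gamma<\infty}\mathcal P_\gamma/\mathcal P_\gamma^+$, where $\mathcal P_\gamma=\{a\in K[x]\mid\nu(a)\geq\gamma\}$ and $\mathcal P_\gamma^+=\{a\in K[x]\mid\nu(a)>\gamma\}$, with multiplication induced by that of $K[x]$ (it is an integral domain). $\mathcal U_\nu$ is the set of units of $\mathcal G_\nu$. For $a\notin\mathrm{supp}(\nu)$, $\mathrm{in}_\nu(a)$ is the image of $a$ in $\mathcal P_{\nu(a)}/\mathcal P_{\nu(a)}^+\subseteq\mathcal G_\nu$; for $a\in\mathrm{supp}(\nu)$, $\mathrm{in}_\nu(a)=0$. $\mathrm{KP}(\nu)$ is the set of Mac Lane–Vaquié key polynomials for $\nu$: monic $Q\in K[x]$ such that $\mathrm{in}_\nu(Q)$ is a prime element of $\mathcal G_\nu$ and, for every nonzero $f\in K[x]$, $\mathrm{in}_\nu(Q)\mid\mathrm{in}_\nu(f)$ implies $\deg(Q)\leq\deg(f)$. (It is known that every homogeneous irreducible element of $\mathcal G_\nu$ has the form $u\cdot\mathrm{in}_\nu(Q)$ with $u\in\mathcal U_\nu$ and $Q\in\ma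thrm{KP}(\nu)$.)
   Formalization: As printed the claim fails when Q = F, since every μ in V_F lies below some μ' of support (F), where μ'(F) = ∞; here α₁ is taken in Γ_∞ and is asserted to lie in Γ whenever Q ≠ F. *)

(* Defs.v *)
From HB Require Import structures.
From mathcomp Require Import all_boot all_order all_algebra.
From mathcomp Require Import finmap.
From mathcomp.multinomials Require Import monalg.

Set Implicit Arguments.
Unset Strict Implicit.
Unset Printing Implicit Defensive.

Import Order.TTheory GRing.Theory.
Local Open Scope ring_scope.

HB.mixin Record isTotallyOrderedGroup G of Num.POrderedZmodule G := {
  ole_total : total (<=%R : rel G);
  oleD2l : forall z : G, {homo +%R z : x y / x <= y}
}.

#[short(type="orderedZmodType")]
HB.structure Definition OrderedZmodule :=
  { G of Num.POrderedZmodule G & isTotallyOrderedGroup G }.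

HB.instance Definition _ (G : orderedZmodType) :=
  Order.POrder_isTotal.Build ring_display (OrderedZmodule.sort G) ole_total.

Definition divisible (G : zmodType) : Prop :=
  forall (n : nat) (x : G), (0 < n)%N -> exists y : G, y *+ n = x.

Section OrderedZmoduleTheory.
Context (G : orderedZmodType).
Implicit Types x y z t : G.

Lemma leD2l z x y : (z + x <= z + y) = (x <= y).
Proof.
apply/idP/idP => [|/oleD2l -> //].
by move=> /(oleD2l (- z)); rewrite !addKr.
Qed.

Lemma ltD2l z x y : (z + x < z + y) = (x < y).
Proof. by rewrite !ltNge leD2l. Qed.

Lemma leD x y z t : x <= y -> z <= t -> x + z <= y + t.
Proof.
move=> xy zt; apply: (@le_trans _ _ (x + t)); first by rewrite leD2l.
by rewrite ![_ + t]addrC leD2l.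
Qed.
End OrderedZmoduleTheory.

(* Gamma_oo: [Fin g] is the element g of Gamma, [Inf] is the symbol oo. *)
Definition withInf (G : Type) : Type := option G.
Definition Fin {G : Type} (g : G) : withInf G := Some g.
Definition Inf {G : Type} : withInf G := None.

Section WithInf.
Context (G : orderedZmodType).
Local Notation Goo := (withInf G).
Implicit Types x y z : Goo.

HB.instance Definition _ := Choice.on Goo.

Definition le_inf x y : bool :=
  match x, y with
  | _, None => true
  | None, Some _ => false
  | Some a, Some b => a <= b
  end.

Definition add_inf x y : Goo :=
  match x, y with
  | Some a, Some b => Fin (a + b)
  | _, _ => Inf
  end.

Fact le_inf_refl : reflexive le_inf.
Proof. by case=> [a|] /=. Qed.

Fact le_inf_anti : antisymmetric le_inf.
Proof. by case=> [a|] [b|] //= /le_anti ->. Qed.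

Fact le_inf_trans : transitive le_inf.
Proof. by case=> [a|] [b|] [c|] //=; apply: le_trans. Qed.

HB.instance Definition _ := Order.Le_isPOrder.Build ring_display Goo
  le_inf_refl le_inf_anti le_inf_trans.

Fact le_inf_total : total (<=%R : rel Goo).
Proof. by case=> [a|] [b|]; rewrite /Order.le //=; apply: le_total. Qed.

HB.instance Definition _ :=
  Order.POrder_isTotal.Build ring_display Goo le_inf_total.

Fact add_infA : associative add_inf.
Proof. by case=> [a|] [b|] [c|] //=; rewrite addrA. Qed.

Fact add_infC : commutative add_inf.
Proof. by case=> [a|] [b|] //=; rewrite addrC. Qed.

Fact add_inf0 : left_id (Fin 0) add_inf.
Proof. by case=> [a|] //=; rewrite add0r. Qed.

HB.instance Definition _ :=
  GRing.isNmodule.Build Goo add_infA add_infC add_inf0.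

Lemma leFin (a b : G) : (Fin a <= Fin b) = (a <= b).
Proof. by []. Qed.

Lemma ltFin (a b : G) : (Fin a < Fin b) = (a < b).
Proof. by rewrite !ltNge leFin. Qed.

Lemma leInf x : x <= Inf.
Proof. by case: x. Qed.

Lemma ltInf (a : G) : Fin a < Inf.
Proof. by rewrite ltNge. Qed.

Lemma FinD (a b : G) : Fin (a + b) = Fin a + Fin b :> Goo.
Proof. by []. Qed.

Lemma le_infD x y z t : x <= y -> z <= t -> x + z <= y + t.
Proof.
case: x y z t => [a|] [b|] [c|] [d|] //= ab cd; try exact: leInf.
exact: (leD ab cd).
Qed.

Lemma lt_le_infD (a c : G) y t :
  Fin a <= y -> Fin c < t -> Fin (a + c) < y + t.
Proof.
case: y t => [b|] [d|] //=; try by move=> *; exact: ltInf.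
move=> ab cd; suff : a + c < b + d by rewrite -ltFin.
rewrite (@lt_le_trans _ _ (a + d)) ?ltD2l ?leD //.
by rewrite -ltFin.
Qed.
End WithInf.

Record valuation (R : comNzRingType) (G : orderedZmodType) := Valuation {
  val_fun :> R -> withInf G;
  valuM : forall a b : R, val_fun (a * b) = val_fun a + val_fun b;
  valuD : forall a b : R,
    Order.min (val_fun a) (val_fun b) <= val_fun (a + b);
  valu1 : val_fun 1 = 0;
  valu0 : val_fun 0 = Inf
}.

(* On a field, valuM and valu1 force nu a <> Inf for all a <> 0. *)
Definition support (R : comNzRingType) (G : orderedZmodType)
  (nu : valuation R G) : R -> Prop := fun a => nu a = Inf.

Section ValuationTheory.
Context (R : comNzRingType) (G : orderedZmodType) (nu : valuation R G).

Lemma valu_geD (x : withInf G) a b :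
  x <= nu a -> x <= nu b -> x <= nu (a + b).
Proof.
by move=> xa xb; apply: (le_trans _ (valuD nu a b)); rewrite le_min xa.
Qed.

Lemma valu_gtD (g : G) a b :
  Fin g < nu a -> Fin g < nu b -> Fin g < nu (a + b).
Proof.
by move=> xa xb; apply: (lt_le_trans _ (valuD nu a b)); rewrite lt_min xa.
Qed.

Lemma valu_ge_sum (I : Type) (r : seq I) (P : pred I) (f : I -> R)
    (x : withInf G) :
  (forall i, P i -> x <= nu (f i)) -> x <= nu (\sum_(i <- r | P i) f i).
Proof.
by move=> H; elim/big_ind: _ => //; [rewrite valu0 leInf | exact: valu_geD].
Qed.

Lemma valu_gt_sum (I : Type) (r : seq I) (P : pred I) (f : I -> R) (g : G) :
  (forall i, P i -> Fin g < nu (f i)) ->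
  Fin g < nu (\sum_(i <- r | P i) f i).
Proof.
by move=> H; elim/big_ind: _ => //; [rewrite valu0 ltInf | exact: valu_gtD].
Qed.

Lemma valuN a : nu (- a) = nu a.
Proof.
suff nu1 : nu (-1) = 0 by rewrite -mulN1r valuM nu1 add0r.
have : nu (-1) + nu (-1) = 0 by rewrite -valuM mulrNN mulr1 valu1.
case: (nu (-1)) => [g|] // [gg]; congr Some.
have [g0|g0|//] := ltgtP g 0.
  by have := ltD2l g g 0; rewrite g0 gg addr0 ltNge (ltW g0).
by have := ltD2l g 0 g; rewrite g0 gg addr0 ltNge (ltW g0).
Qed.
End ValuationTheory.

(* The group algebra R[G], on finitely supported functions G -> R with the     *)
(* convolution product; [mcoeff g c] is the coefficient of c at g and          *)
(* [mkmalgU g a] is the function with value a at g and 0 elsewhere. The        *)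
(* ring structure of {malg R[G]} does not apply: it needs an index monoid      *)
(* without nontrivial units.                                                   *)
Definition galg (R : comNzRingType) (G : zmodType) : Type := {malg R[G]}.

Section GroupAlgebra.
Context (R : comNzRingType) (G : zmodType).
Local Notation A := (galg R G).
Local Open Scope fset_scope.
Local Open Scope ring_scope.
Implicit Types (c d e : A) (g h k : G).

HB.instance Definition _ := GRing.Zmodule.on A.

Definition galg_one : A := mkmalgU 0 1.

Definition galg_mul c d : A :=
  \sum_(g <- msupp c) \sum_(h <- msupp d)
     mkmalgU (g + h) (mcoeff g c * mcoeff h d).

Fact galg_mulw (X Y : {fset G}) c d : msupp c `<=` X -> msupp d `<=` Y ->
  galg_mul c d = \sum_(g <- X) \sum_(h <- Y)
     mkmalgU (g + h) (mcoeff g c * mcoeff h d).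
Proof.
move=> cX dY; rewrite /galg_mul (big_fset_incl _ cX) /=.
  apply/eq_bigr=> k1 _; apply/big_fset_incl => // k _ /mcoeff_outdom ->.
  by rewrite mulr0 monalgU0.
move=> k _ /mcoeff_outdom g1k.
by rewrite big1 => // k' _; rewrite g1k mul0r monalgU0.
Qed.

Fact galg_mulC : commutative galg_mul.
Proof.
move=> c d; rewrite /galg_mul exchange_big /=.
by apply: eq_bigr => g _; apply: eq_bigr => h _; rewrite mulrC addrC.
Qed.

Fact galg_mulDl : left_distributive galg_mul +%R.
Proof.
move=> c d e; rewrite (galg_mulw (msuppD_le c d) (fsubset_refl (msupp e))).
rewrite (galg_mulw (fsubsetUl _ (msupp d)) (fsubset_refl (msupp e))).
rewrite (galg_mulw (fsubsetUr (msupp c) _) (fsubset_refl (msupp e))).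
rewrite -big_split /=; apply/eq_bigr=> k1 _.
rewrite -big_split /=; apply/eq_bigr=> k2 _.
by rewrite mcoeffD mulrDl monalgUD.
Qed.

Fact galg_mulDr : right_distributive galg_mul +%R.
Proof. by move=> c d e; rewrite !(galg_mulC c) galg_mulDl. Qed.

Fact galg_mul0l : left_zero 0 galg_mul.
Proof. by move=> c; rewrite /galg_mul msupp0 big_seq_fset0. Qed.

Fact galg_mul0r : right_zero 0 galg_mul.
Proof. by move=> c; rewrite galg_mulC galg_mul0l. Qed.

Fact galg_mulUU g h (a b : R) :
  galg_mul (mkmalgU g a) (mkmalgU h b) = mkmalgU (g + h) (a * b).
Proof. by rewrite (galg_mulw msuppU_le msuppU_le) !big_seq_fset1 !mcoeffUU. Qed.

Fact galg_mul_suml (I : Type) (r : seq I) (f : I -> A) d :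
  galg_mul (\sum_(i <- r) f i) d = \sum_(i <- r) galg_mul (f i) d.
Proof.
exact: (big_morph (galg_mul^~ d) (fun _ _ => galg_mulDl _ _ _) (galg_mul0l _)).
Qed.

Fact galg_mul_sumr (I : Type) (r : seq I) (f : I -> A) d :
  galg_mul d (\sum_(i <- r) f i) = \sum_(i <- r) galg_mul d (f i).
Proof. by rewrite galg_mulC galg_mul_suml; under eq_bigr do rewrite galg_mulC. Qed.

Fact galg_mulEl c d :
  galg_mul c d = \sum_(g <- msupp c) galg_mul (mkmalgU g (mcoeff g c)) d.
Proof. by rewrite [in LHS](monalgE c) galg_mul_suml. Qed.

Fact galg_mulEr c d :
  galg_mul c d = \sum_(g <- msupp d) galg_mul c (mkmalgU g (mcoeff g d)).
Proof. by rewrite [in LHS](monalgE d) galg_mul_sumr. Qed.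

Fact galg_mulA : associative galg_mul.
Proof.
move=> c d e; rewrite [LHS]galg_mulEl [galg_mul c d]galg_mulEl galg_mul_suml.
apply: eq_bigr => g _; rewrite [galg_mul d e]galg_mulEl galg_mul_sumr.
rewrite [galg_mul _ d]galg_mulEr galg_mul_suml; apply: eq_bigr => h _.
rewrite [galg_mul _ e]galg_mulEr galg_mul_sumr [RHS]galg_mulEr.
by apply: eq_bigr => k _; rewrite !galg_mulUU mulrA addrA.
Qed.

Fact galg_mul1 : left_id galg_one galg_mul.
Proof.
move=> c; rewrite [c in LHS]monalgE [RHS]monalgE galg_mul_sumr.
by apply: eq_bigr => g _; rewrite galg_mulUU mul1r add0r.
Qed.

Fact galg_one_neq0 : galg_one != 0.
Proof. by apply/eqP/malgP => /(_ 0) /eqP; rewrite mcoeffUU mcoeff0 oner_eq0. Qed.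

HB.instance Definition _ := GRing.Zmodule_isComNzRing.Build A
  galg_mulA galg_mulC galg_mul1 galg_mulDl galg_one_neq0.

Lemma mcoeff_galg1 g : mcoeff g (1 : A) = 1 *+ (0 == g).
Proof. exact: mcoeffU. Qed.

Lemma mcoeff_galgM c d k :
  mcoeff k (c * d) = \sum_(g <- msupp c) \sum_(h <- msupp d)
     (mcoeff g c * mcoeff h d) *+ (g + h == k).
Proof.
rewrite [c * d]/(galg_mul c d) raddf_sum; apply: eq_bigr => g _.
by rewrite raddf_sum; apply: eq_bigr => h _; rewrite /= mcoeffU.
Qed.
End GroupAlgebra.

Section GradedRing.
Context (R : comNzRingType) (G : orderedZmodType) (nu : valuation R G).

(* Families (a_g) with a_g in P_g, for all g.                                  *)
Definition reesPred : {pred galg R G} :=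
  fun c => all (fun g => Fin g <= nu (mcoeff g c)) (msupp c).

Lemma reesP (c : galg R G) :
  reflect (forall g, Fin g <= nu (mcoeff g c)) (c \in reesPred).
Proof.
apply: (iffP allP) => [H g|H g _]; last exact: H.
have [/H //|gNc] := boolP (g \in msupp c).
by rewrite (mcoeff_outdom gNc) valu0 leInf.
Qed.

Fact rees_subring : subring_closed reesPred.
Proof.
split.
- apply/reesP => g; rewrite mcoeff_galg1; have [<-|_] := eqVneq; first by rewrite valu1.
  by rewrite valu0 leInf.
- move=> c d /reesP cP /reesP dP; apply/reesP => g.
  by rewrite mcoeffB valu_geD // valuN.
- move=> c d /reesP cP /reesP dP; apply/reesP => k; rewrite mcoeff_galgM.
  apply: valu_ge_sum => g _; apply: valu_ge_sum => h _.
  have [<-|_] := eqVneq; last by rewrite valu0 leInf.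
  by rewrite valuM FinD le_infD.
Qed.

HB.instance Definition _ := GRing.isSubringClosed.Build (galg R G) reesPred
  rees_subring.

Record rees := Rees { rees_val :> galg R G; reesPr : rees_val \in reesPred }.
HB.instance Definition _ := [isSub for rees_val].
HB.instance Definition _ := [Choice of rees by <:].
HB.instance Definition _ := [SubChoice_isSubComNzRing of rees by <:].

(* Families (a_g) with a_g in P_g^+, for all g.                                *)
Definition reesIdeal : {pred rees} :=
  fun c => all (fun g => Fin g < nu (mcoeff g (val c))) (msupp (val c)).

Lemma reesIdealP (c : rees) :
  reflect (forall g, Fin g < nu (mcoeff g (val c))) (c \in reesIdeal).
Proof.
apply: (iffP allP) => [H g|H g _]; last exact: H.
have [/H //|gNc] := boolP (g \in msupp (val c)).
by rewrite (mcoeff_outdom gNc) valu0 ltInf.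
Qed.

Fact reesIdeal_closed : idealr_closed reesIdeal.
Proof.
split.
- by apply/reesIdealP => g; rewrite mcoeff0 valu0 ltInf.
- by apply/negP => /reesIdealP /(_ 0); rewrite mcoeff_galg1 eqxx valu1 ltxx.
- move=> a c d /reesIdealP cP /reesIdealP dP; apply/reesIdealP => k.
  rewrite mcoeffD valu_gtD // mcoeff_galgM.
  apply: valu_gt_sum => g _; apply: valu_gt_sum => h _.
  have [<-|_] := eqVneq; last by rewrite valu0 ltInf.
  by rewrite valuM lt_le_infD //; move/reesP: (reesPr a).
Qed.

HB.instance Definition _ := isIdealr.Build rees reesIdeal reesIdeal_closed.
End GradedRing.

(* G_nu, as the quotient of { (a_g) finitely supported | a_g in P_g } by       *)
(* { (a_g) | a_g in P_g^+ }, which is the direct sum of the P_g / P_g^+. The   *)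
(* sum runs over all g in Gamma: for g outside nu(R), P_g = P_g^+ and the      *)
(* component is zero.                                                          *)
Definition graded (R : comNzRingType) (G : orderedZmodType)
  (nu : valuation R G) : Type := {ideal_quot @reesIdeal R G nu}.

HB.instance Definition _ (R : comNzRingType) (G : orderedZmodType)
  (nu : valuation R G) := GRing.ComNzRing.on (graded nu).

Section Graded.
Context (R : comNzRingType) (G : orderedZmodType) (nu : valuation R G).

Fact rees_mono_subproof (g : G) (a : R) :
  Fin g <= nu a -> (mkmalgU g a : galg R G) \in reesPred nu.
Proof.
move=> ga; apply/reesP => h; rewrite mcoeffU.
by have [<-|_] := eqVneq; rewrite // valu0 leInf.
Qed.

(* The class in P_g / P_g^+ of a in P_g. *)
Definition gr_class (g : G) (a : R) (ga : Fin g <= nu a) : graded nu :=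
  (\pi_{ideal_quot @reesIdeal R G nu} (Rees (rees_mono_subproof ga)))%qT.

Definition homogeneous (phi : graded nu) : Prop :=
  exists (g : G) (a : R) (ga : Fin g <= nu a), phi = gr_class ga.

Fact val_fin_subproof (a : R) (g : G) : nu a = Fin g -> Fin g <= nu a.
Proof. by move->. Qed.

Definition initial (a : R) : graded nu :=
  match nu a as x return nu a = x -> graded nu with
  | Some g => fun e => gr_class (val_fin_subproof e)
  | None => fun _ => 0
  end erefl.
End Graded.

Arguments gr_class {R G nu g a} ga.
Arguments homogeneous {R G nu} phi.
Arguments initial {R G} nu a.

Section RingDivisibility.
Context (R : comNzRingType).
Implicit Types a b p u : R.

Definition ring_dvd a b : Prop := exists c, b = c * a.

Definition ring_unit u : Prop := exists v, v * u = 1.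

Definition ring_prime p : Prop :=
  [/\ p <> 0, ~ ring_unit p &
      forall a b, ring_dvd p (a * b) -> ring_dvd p a \/ ring_dvd p b].

Definition ring_irreducible p : Prop :=
  [/\ p <> 0, ~ ring_unit p &
      forall a b, p = a * b -> ring_unit a \/ ring_unit b].
End RingDivisibility.

Section ValuationTree.
Context (K : fieldType) (G : orderedZmodType) (nu0 : valuation K G).

Record extension := Extension {
  ext_val :> valuation {poly K} G;
  ext_extends : forall a : K, ext_val a%:P = nu0 a
}.

(* The set V: [Root] is the element nu_0, the least element of V. *)
Inductive tree : Type := Root | Ext of extension.

Definition tree_le (nu mu : tree) : Prop :=
  match nu, mu with
  | Root, _ => True
  | Ext _, Root => False
  | Ext nu', Ext mu' => forall f : {poly K}, nu' f <= mu' f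
  end.

Definition maximal (nu : tree) : Prop :=
  forall mu : tree, tree_le nu mu -> tree_le mu nu.

Definition in_tree_inf (F : {poly K}) (mu : tree) : Prop :=
  match mu with
  | Root => False
  | Ext mu' => forall f : {poly K}, support mu' f <-> F %| f
  end.

Definition in_tree (F : {poly K}) (nu : tree) : Prop :=
  exists2 mu : tree, in_tree_inf F mu & tree_le nu mu.

Definition key_poly (nu : extension) (Q : {poly K}) : Prop :=
  [/\ Q \is monic, ring_prime (initial nu Q) &
      forall f : {poly K}, f != 0 ->
        ring_dvd (initial nu Q) (initial nu f) -> (size Q <= size f)%N].
End ValuationTree.

Arguments Root {K G nu0}.

(* Main.v *)
Require Import Defs.
From HB Require Import structures.
From mathcomp Require Import all_boot all_order all_algebra.
From mathcomp.multinomials Require Import monalg.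
From mathcomp Require Import boolp classical_sets.
From mathcomp Require Import qfpoly.
From mathcomp Require Import ring.

Set Implicit Arguments.
Unset Strict Implicit.
Unset Printing Implicit Defensive.

Import Order.TTheory GRing.Theory.
Local Open Scope ring_scope.

(** For [Q = F], any valuation of support [(F)] above [nu] gives the infinite
    value to [Q], and so does everything above it.

    For [Q <> F], a valuation [mu] of support [(F)] is the pullback of a
    valuation of the field [L = K[x]/(F)], and two comparable valuations of a
    field are equal; so nothing in the tree lies strictly above [mu]
    ([leaf_maximal]), and [mu Q] is finite since [F] does not divide [Q].  It is
    therefore enough to find such a [mu] above [nu] with [nu Q < mu Q]
    ([extension_over_factor]): the divisor [in(Q)] of [in(F)] selects which of
    the extensions of [nu0] to [L] to take.

    This is an instance of the classical proof that a local ring is dominated by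
    a valuation ring, carried out with homogeneous elements of [L[t^Gamma]].
    The image of the Rees ring of [nu] in [L[t^Gamma]] is a graded ring, and the
    elements of larger value together with [Q t^(nu Q)] generate a homogeneous
    ideal of it.  This ideal is proper: modulo it, the ring is a quotient of
    [G_nu] by [(in(Q), in(F)) = (in(Q))], and [in(Q)] is not a unit
    ([no_unit_combination]).  By Zorn's lemma such a pair (graded ring, proper
    ideal) is contained in a maximal one, and maximality forces, for each
    homogeneous [x t^g], that [x t^g] lies in the ideal or that its inverse lies
    in the ring ([maximal_dichotomy]).  As [L] is algebraic over [K] and [Gamma]
    is divisible, every nonzero [x] has a degree [g] in which [x t^g] is a unit
    of the maximal ring ([algebraic_exact]); sending [x] to this degree is the
    valuation of [L] that is looked for ([pair_valuation]). *)

(** * Graded subrings with a proper ideal *)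

Section GradedPairs.
Context (L : fieldType) (G : orderedZmodType).
Implicit Types (x y a : L) (g h : G) (p q : {poly L}).

(** A homogeneous subring of the group algebra [L[t^G]] with a proper homogeneous
    ideal: [gint x g] says that [x t^g] belongs to the ring, [gid x g] that it
    belongs to the ideal.  For a valuation [w] of [L] these are [g <= w x] and
    [g < w x]. *)
Record graded_pair := GradedPair {
  gint : L -> G -> Prop;
  gid : L -> G -> Prop;
  gint0 : forall g, gint 0 g;
  gint1 : gint 1 0;
  gintB : forall a b g, gint a g -> gint b g -> gint (a - b) g;
  gintM : forall a b g h, gint a g -> gint b h -> gint (a * b) (g + h);
  gid0 : forall g, gid 0 g;
  gidD : forall a b g, gid a g -> gid b g -> gid (a + b) g;
  gidM : forall a b g h, gint a g -> gid b h -> gid (a * b) (g + h);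
  gid_int : forall a g, gid a g -> gint a g;
  gid_proper : ~ gid 1 0
}.
Implicit Type P : graded_pair.

Lemma gintN P a g : gint P a g -> gint P (- a) g.
Proof. by move=> aP; rewrite -[- a]add0r; apply/gintB/aP/gint0. Qed.

Lemma gintD P a b g : gint P a g -> gint P b g -> gint P (a + b) g.
Proof. by move=> aP bP; rewrite -[b]opprK; apply/gintB/gintN. Qed.

Lemma gidMr P a b g h : gid P a g -> gint P b h -> gid P (a * b) (g + h).
Proof. by move=> aP bP; rewrite mulrC addrC; apply: gidM. Qed.

Lemma gidN P a g : gid P a g -> gid P (- a) g.
Proof.
move=> aP; rewrite -mulN1r -[g]add0r; apply: gidM => //.
exact/gintN/gint1.
Qed.

Definition pair_le P P' : Prop :=
  (forall a g, gint P a g -> gint P' a g) /\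
  (forall a g, gid P a g -> gid P' a g).

Lemma pair_le_refl P : pair_le P P. Proof. by split. Qed.

Lemma pair_le_trans P2 P1 P3 : pair_le P1 P2 -> pair_le P2 P3 -> pair_le P1 P3.
Proof. by move=> [i12 d12] [i23 d23]; split=> a g; [move/i12/i23|move/d12/d23]. Qed.

Section ChainUnion.
Variables (C : set graded_pair) (C_total : total_on C pair_le).
Variables (P0 : graded_pair) (CP0 : C P0).

Let union_int a g := exists2 P, C P & gint P a g.
Let union_id a g := exists2 P, C P & gid P a g.

Let common P1 P2 : C P1 -> C P2 ->
  exists P, [/\ C P, pair_le P1 P & pair_le P2 P].
Proof.
move=> C1 C2; case: (C_total C1 C2) => le12.
  by exists P2; split=> //; apply: pair_le_refl.
by exists P1; split=> //; apply: pair_le_refl.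
Qed.

Lemma chain_bound : exists P, forall P', C P' -> pair_le P' P.
Proof.
have i0 g : union_int 0 g by exists P0 => //; apply: gint0.
have i1 : union_int 1 0 by exists P0 => //; apply: gint1.
have iB a b g : union_int a g -> union_int b g -> union_int (a - b) g.
  move=> [P1 C1 a1] [P2 C2 b2]; have [P [CP [l1 _] [l2 _]]] := common C1 C2.
  by exists P => //; apply: gintB; auto.
have iM a b g h : union_int a g -> union_int b h -> union_int (a * b) (g + h).
  move=> [P1 C1 a1] [P2 C2 b2]; have [P [CP [l1 _] [l2 _]]] := common C1 C2.
  by exists P => //; apply: gintM; auto.
have d0 g : union_id 0 g by exists P0 => //; apply: gid0.
have dD a b g : union_id a g -> union_id b g -> union_id (a + b) g.
  move=> [P1 C1 a1] [P2 C2 b2]; have [P [CP [_ l1] [_ l2]]] := common C1 C2.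
  by exists P => //; apply: gidD; auto.
have dM a b g h : union_int a g -> union_id b h -> union_id (a * b) (g + h).
  move=> [P1 C1 a1] [P2 C2 b2]; have [P [CP [l1 _] [_ l2]]] := common C1 C2.
  by exists P => //; apply: gidM; auto.
have di a g : union_id a g -> union_int a g.
  by move=> [P CP aP]; exists P => //; apply: gid_int.
have dP : ~ union_id 1 0 by case=> P _; apply: gid_proper.
by exists (GradedPair i0 i1 iB iM d0 dD dM di dP) => P CP; split=> a g aP; exists P.
Qed.
End ChainUnion.

Definition maximal_pair P := forall P', pair_le P P' -> pair_le P' P.

Lemma maximal_pair_above P0 : exists2 P, pair_le P0 P & maximal_pair P.
Proof.
pose T := {P | pair_le P0 P}.
pose R (s t : T) := `[< pair_le (sval s) (sval t) >].
have [|||[P leP] maxP] := @ZL_preorder T (exist _ P0 (pair_le_refl P0)) R.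
- by move=> t; apply/asboolP/pair_le_refl.
- by move=> r s t /asboolP rs /asboolP st; apply/asboolP/(pair_le_trans rs st).
- move=> A totA; case: (pselect (exists t, A t)) => [[t0 At0]|noA]; last first.
    by exists (exist _ P0 (pair_le_refl P0)) => s As; case: noA; exists s.
  pose C P := exists2 t, A t & sval t = P.
  have totC : total_on C pair_le.
    move=> _ _ [s As <-] [t At <-].
    by case: (totA _ _ As At) => /asboolP; [left|right].
  have C0 : C (sval t0) by exists t0.
  have [P leP] := chain_bound totC C0.
  have P0P : pair_le P0 P := pair_le_trans (proj2_sig t0) (leP _ C0).
  by exists (exist _ P P0P) => s As; apply/asboolP/leP; exists s.
exists P => // P' leP'.
by move: (maxP (exist _ P' (pair_le_trans leP leP')) (asboolT leP')) => /asboolP.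
Qed.

(** * Adjoining an element to a maximal pair *)

(** The condition on the coefficient of [x^i] in an element of the ideal of
    [A[x]] extending the ideal [I] of [A]: that ideal is [I[x]] for [b = false]
    and [I[x] + xA[x]], which contains [x], for [b = true]. *)
Definition coef_in P (b : bool) (i : nat) := if b && (0 < i)%N then gint P else gid P.

Lemma coef_in_gint P b i a g : coef_in P b i a g -> gint P a g.
Proof. by rewrite /coef_in; case: ifP => // _; apply: gid_int. Qed.

Lemma gid_coef_in P b i a g : gid P a g -> coef_in P b i a g.
Proof. by rewrite /coef_in; case: ifP => // _; apply: gid_int. Qed.

Lemma coef_in0 P b i g : coef_in P b i 0 g.
Proof. exact/gid_coef_in/gid0. Qed.

Lemma coef_inD P b i a a' g :
  coef_in P b i a g -> coef_in P b i a' g -> coef_in P b i (a + a') g.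
Proof. by rewrite /coef_in; case: ifP => _; [apply: gintD|apply: gidD]. Qed.

Lemma coef_inM P b i j a a' g h : (j <= i)%N ->
  gint P a g -> coef_in P b j a' h -> coef_in P b i (a * a') (g + h).
Proof.
case: j => [|j].
  rewrite /coef_in andbF => _ aP a0.
  by case: ifP => _; [apply/gid_int/gidM|apply: gidM].
by case: i => // i _; rewrite /coef_in !andbT; case: b => /=; [apply: gintM|apply: gidM].
Qed.

Definition adj_int P x g a h :=
  exists2 p, p.[x] = a & forall i, gint P p`_i (h - g *+ i).

Definition adj_id P b x g a h :=
  exists2 p, p.[x] = a & forall i, coef_in P b i p`_i (h - g *+ i).

Let degD g h h' i j : (j <= i)%N ->
  (h - g *+ j) + (h' - g *+ (i - j)) = h + h' - g *+ i.
Proof. by move=> ji; rewrite addrACA -opprD -mulrnDr subnKC. Qed.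

(** If the extended ideal is proper, then [x t^g] can be adjoined to the ring,
    and even to the ideal when [b] holds. *)
Lemma adjoin P b x g : ~ adj_id P b x g 1 0 ->
  exists P', [/\ pair_le P P', gint P' x g & b -> gid P' x g].
Proof.
move=> dP.
have cst c i h (Z : L -> G -> Prop) :
    Z c h -> (forall h', Z 0 h') -> Z (c%:P)`_i (h - g *+ i).
  by rewrite coefC; case: i => [|i] //=; rewrite subr0.
have i0 h : adj_int P x g 0 h.
  by exists 0; rewrite ?horner0 // => i; rewrite coef0; apply: gint0.
have i1 : adj_int P x g 1 0.
  by exists 1%:P; rewrite ?hornerC // => i; apply: cst; [apply: gint1|apply: gint0].
have iB a c h : adj_int P x g a h -> adj_int P x g c h -> adj_int P x g (a - c) h.
  move=> [p <- pP] [q <- qP]; exists (p - q); first by rewrite hornerD hornerN.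
  by move=> i; rewrite coefB; apply: gintB.
have iM a c h h' : adj_int P x g a h -> adj_int P x g c h' ->
    adj_int P x g (a * c) (h + h').
  move=> [p <- pP] [q <- qP]; exists (p * q); first by rewrite hornerM.
  move=> i; rewrite coefM; elim/big_ind: _ => [|y z|j _]; [exact: gint0|exact: gintD|].
  by rewrite -(degD _ _ _ (leq_ord j)); apply: gintM.
have d0 h : adj_id P b x g 0 h.
  by exists 0; rewrite ?horner0 // => i; rewrite coef0; apply: coef_in0.
have dD a c h : adj_id P b x g a h -> adj_id P b x g c h -> adj_id P b x g (a + c) h.
  move=> [p <- pP] [q <- qP]; exists (p + q); first by rewrite hornerD.
  by move=> i; rewrite coefD; apply: coef_inD.
have dM a c h h' : adj_int P x g a h -> adj_id P b x g c h' ->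
    adj_id P b x g (a * c) (h + h').
  move=> [p <- pP] [q <- qP]; exists (p * q); first by rewrite hornerM.
  move=> i; rewrite coefM; elim/big_ind: _ => [|y z|j _].
  - exact: coef_in0.
  - exact: coef_inD.
  by rewrite -(degD _ _ _ (leq_ord j)); exact: coef_inM (leq_subr j i) (pP _) (qP _).
have di a h : adj_id P b x g a h -> adj_int P x g a h.
  by move=> [p <- pP]; exists p => // i; apply/coef_in_gint/pP.
exists (GradedPair i0 i1 iB iM d0 dD dM di dP); split=> [||b1] /=.
- split=> a h aP; exists a%:P; rewrite ?hornerC // => i; apply: cst => //.
  + exact: gint0.
  + exact: gid_coef_in.
  + exact: coef_in0.
- exists 'X; rewrite ?hornerX // => i; rewrite coefX; case: eqP => [->|_].
    by rewrite mulr1n subrr; apply: gint1.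
  exact: gint0.
- exists 'X; rewrite ?hornerX // => i; rewrite coefX; case: eqP => [->|_].
    by rewrite mulr1n subrr /coef_in b1; apply: gint1.
  exact: coef_in0.
Qed.

(** From [p.[x] = 1] and [q.[x^-1] = 1], that is,
    [1 - q_0 = sum_(j > 0) q_j x^-j], the leading term [p_(k+1) x^(k+1)] of [p] is
    eliminated by multiplying the first relation by [1 - q_0]. *)
Definition elim_lead k p q : {poly L} :=
  \poly_(i < k.+1) (q`_0 *+ (i == 0)%N + (1 - q`_0) * p`_i + p`_k.+1 * q`_(k.+1 - i)).

Lemma horner_elim_lead k p q x y : x * y = 1 ->
  (size p <= k.+2)%N -> (size q <= k.+2)%N -> p.[x] = 1 -> q.[y] = 1 ->
  (elim_lead k p q).[x] = 1.
Proof.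
move=> xy sp sq px qy; rewrite horner_poly.
under eq_bigr do rewrite !mulrDl -!mulrA.
rewrite !big_split /= -!mulr_sumr.
have -> : \sum_(i < k.+1) q`_0 *+ (i == 0 :> nat) * x ^+ i = q`_0.
  by rewrite big_ord_recl /= big1 ?addr0 ?mulr1 // => i _; rewrite mul0r.
have -> : \sum_(i < k.+1) p`_i * x ^+ i = 1 - p`_k.+1 * x ^+ k.+1.
  by have := horner_coef_wide x sp; rewrite px big_ord_recr /= => ->; rewrite addrK.
have -> : \sum_(i < k.+1) q`_(k.+1 - i) * x ^+ i = x ^+ k.+1 * (1 - q`_0).
  have := horner_coef_wide y sq; rewrite qy big_ord_recl /= expr0 mulr1 => ->.
  rewrite [q`_0 + _]addrC addrK.
  rewrite (reindex_inj rev_ord_inj) mulr_sumr; apply: eq_bigr => j _ /=.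
  have jk : (j.+1 <= k.+1)%N by [].
  rewrite /bump !add1n subKn // mulrCA; congr (_ * _).
  have -> : x ^+ k.+1 = x ^+ (k.+1 - j.+1) * x ^+ j.+1 by rewrite -exprD subnK.
  by rewrite -mulrA -exprMn xy expr1n mulr1.
ring.
Qed.

(** Whichever of the two relations has the larger degree can be shortened with
    the other one by [elim_lead], without leaving the ideals concerned; this
    cannot go on below degree one, where a relation says that the ideal
    contains 1. *)
Lemma no_common_relation P x y g n p q : x * y = 1 ->
  (size p + size q <= n)%N ->
  p.[x] = 1 -> (forall i, coef_in P true i p`_i (- (g *+ i))) ->
  q.[y] = 1 -> (forall i, gid P q`_i (g *+ i)) -> False.
Proof.
move=> xy; elim: n p q => [|n IHn] p q.
  rewrite leqn0 addn_eq0 size_poly_eq0 => /andP[/eqP-> _] /eqP.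
  by rewrite horner0 eq_sym oner_eq0.
move=> spq px pP qy qP.
have deg i k : (i <= k)%N -> - (g *+ k) + g *+ (k - i) = - (g *+ i).
  by move=> ik; rewrite mulrnBr // addrA addNr sub0r.
have p0 : gid P p`_0 0 by have := pP 0; rewrite /coef_in mulr0n oppr0.
have q0 : gid P q`_0 0 by exact: qP.
have cstD r z : r.[z] = 1 -> gid P r`_0 0 -> (1 < size r)%N.
  move=> rz r0; rewrite ltnNge; apply/negP => /size1_polyC rE.
  by apply: (@gid_proper P); rewrite -rz rE hornerC.
have [spq'|spq'] := leqP (size q) (size p).
  case sp: (size p) (cstD _ _ px p0) => [|[|k]] // _.
  apply: (IHn (elim_lead k p q) q) => //.
  - by rewrite -ltnS (leq_trans _ spq) // sp ltn_add2r ltnS size_poly.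
  - by apply: (horner_elim_lead xy) => //; rewrite -sp.
  move=> i; rewrite coef_poly; case: ifP => [ik|_]; last exact: coef_in0.
  apply: coef_inD; last first.
    by rewrite -(deg i k.+1) 1?ltnW //; apply/gid_coef_in/gidM/qP/(coef_in_gint (pP _)).
  apply: coef_inD; last first.
    rewrite -[- (g *+ i)]add0r; apply: (coef_inM (leqnn i)) (pP i).
    exact/gintB/gid_int/q0/gint1.
  by case: i {ik} => [|i] /=; [rewrite mulr0n oppr0; apply/gid_coef_in|apply: coef_in0].
case sq: (size q) (cstD _ _ qy q0) => [|[|k]] // _.
apply: (IHn p (elim_lead k q p)) => //.
- by rewrite -ltnS (leq_trans _ spq) // sq ltn_add2l ltnS size_poly.
- apply: (horner_elim_lead (y := x)); rewrite ?[y * x]mulrC ?sq //.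
  by rewrite -sq ltnW.
move=> i; rewrite coef_poly; case: ifP => [ik|_]; last exact: gid0.
apply: gidD; last first.
  have -> : g *+ i = g *+ k.+1 + - (g *+ (k.+1 - i)).
    by rewrite -[RHS]opprK opprD opprK deg 1?ltnW // opprK.
  exact: gidMr (qP _) (coef_in_gint (pP _)).
apply: gidD; last first.
  by rewrite -[g *+ i]add0r; apply/gidM/qP/gintB/gid_int/p0/gint1.
by case: i {ik} => [|i] //=; apply: gid0.
Qed.

(** By maximality, failure of the first alternative gives a relation for [x] in
    [I[x] + xA[x]], and failure of the second one a relation for [x^-1] in
    [I[x^-1]]. *)
Lemma maximal_dichotomy P x g : maximal_pair P -> x != 0 ->
  gid P x g \/ gint P x^-1 (- g).
Proof.
move=> maxP x0; have [[p px pP]|] := pselect (adj_id P true x g 1 0); last first.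
  by move=> /adjoin[P' [/maxP[_ le'] _ /(_ isT)/le']]; left.
have [[q qx qP]|] := pselect (adj_id P false x^-1 (- g) 1 0); last first.
  by move=> /adjoin[P' [/maxP[le' _] /le']]; right.
case: (@no_common_relation P x x^-1 g _ p q (divff x0) (leqnn _) px _ qx).
  by move=> i; have := pP i; rewrite sub0r.
by move=> i; have := qP i; rewrite sub0r mulNrn opprK.
Qed.


(** * From a pair with the dichotomy to a valuation *)

(** Under the dichotomy below, [x t^g] is then a unit of the ring: the valuation
    to be defined takes the value [g] at [x]. *)
Definition exact_degree P x g := gint P x g /\ ~ gid P x g.

Section Dichotomy.
Variable P : graded_pair.
Hypothesis dich : forall x g, x != 0 -> gid P x g \/ gint P x^-1 (- g).

Lemma exact_neq0 x g : exact_degree P x g -> x != 0.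
Proof. by move=> [_ xP]; apply/eqP => x0; apply: xP; rewrite x0; apply: gid0. Qed.

Lemma exact_inv x g : exact_degree P x g -> gint P x^-1 (- g).
Proof. by move=> xg; case: (dich g (exact_neq0 xg)) => // /(proj2 xg). Qed.

Lemma gid_not_inv x g : x != 0 -> gid P x g -> ~ gint P x^-1 (- g).
Proof.
move=> x0 xP xV; apply: (@gid_proper P).
by rewrite -(mulVf x0) -(addNr g); apply: gidM.
Qed.

Lemma exactP x g : x != 0 ->
  exact_degree P x g <-> gint P x g /\ gint P x^-1 (- g).
Proof.
move=> x0; split=> [xg|[xP xV]]; first by split; [case: xg|apply: exact_inv].
by split=> // /gid_not_inv /(_ xV); apply.
Qed.

Lemma exactM x y g h :
  exact_degree P x g -> exact_degree P y h -> exact_degree P (x * y) (g + h).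
Proof.
move=> xg yh; have [x0 y0] := (exact_neq0 xg, exact_neq0 yh).
apply/exactP; first by rewrite mulf_neq0.
split; first by apply: gintM; [case: xg|case: yh].
by rewrite invfM opprD; apply: gintM; apply: exact_inv.
Qed.

Lemma exactV x g : exact_degree P x g -> exact_degree P x^-1 (- g).
Proof.
move=> xg; have x0 := exact_neq0 xg; apply/exactP; rewrite ?invr_eq0 //.
by split; [apply: exact_inv|rewrite invrK opprK; case: xg].
Qed.

Lemma trichotomy x g : x != 0 ->
  [\/ gid P x g, exact_degree P x g | gid P x^-1 (- g)].
Proof.
move=> x0; have [?|xV] := dich g x0; first by constructor 1.
have [?|xP] := dich (- g) (invr_neq0 x0); first by constructor 3.
by constructor 2; apply/exactP => //; rewrite invrK opprK in xP.
Qed.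

Lemma gidX x g n : gid P x g -> (0 < n)%N -> gid P (x ^+ n) (g *+ n).
Proof.
move=> xP; elim: n => // -[|n] IHn _; first by rewrite expr1 mulr1n.
by rewrite exprS mulrS; apply/gidM/IHn => //; apply: gid_int.
Qed.

Lemma exact_root x g n : (0 < n)%N ->
  exact_degree P (x ^+ n) (g *+ n) -> exact_degree P x g.
Proof.
move=> n0 xn; have x0 : x != 0 by have := exact_neq0 xn; rewrite expf_eq0 n0.
have [xg|//|xg] := trichotomy g x0; first by case: (proj2 xn (gidX xg n0)).
case: (proj2 (exactV xn)).
by rewrite -exprVn -mulNrn; apply: gidX.
Qed.

Lemma exactD x y g : exact_degree P x g -> gid P y g -> exact_degree P (x + y) g.
Proof.
move=> [xP xN] yP; split; first exact/gintD/gid_int.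
by move=> /gidD/(_ (gidN yP)); rewrite addrK.
Qed.

(** In a vanishing sum two nonzero terms must have the same value, so that
    [x^(m-i)] has a degree for some [i < m], and [x] has one by divisibility.
    The proof assumes that [x] has no degree; then no two terms are equivalent
    in degree 0, and inductively each partial sum is equivalent to one of its
    terms, hence nonzero. *)
Lemma algebraic_exact (c : nat -> L) n x : divisible G ->
  (forall i, c i != 0 -> exists g, exact_degree P (c i) g) ->
  x != 0 -> \sum_(i < n) c i * x ^+ i = 0 -> (exists2 i, (i < n)%N & c i != 0) ->
  exists g, exact_degree P x g.
Proof.
move=> Gdiv c_exact x0 sum0 [i0 i0n ci0]; apply: contrapT => x_none.
suff dom m : (forall i, (i < m)%N -> c i = 0) \/ exists i, [/\ (i < m)%N, c i != 0 &
    exact_degree P ((\sum_(j < m) c j * x ^+ j) / (c i * x ^+ i)) 0].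
  case: (dom n) => [/(_ _ i0n)/eqP|[i [_ _]]]; first by apply/negP.
  by move/exact_neq0; rewrite sum0 mul0r eqxx.
elim: m => [|m IHm]; first by left.
rewrite big_ord_recr /=; set s := \sum_(i < m) _ in IHm *.
have [cm0|cm0] := eqVneq (c m) 0.
  rewrite cm0 mul0r addr0; case: IHm => [c0|[i [im ci si]]]; [left|right].
    by move=> i; rewrite ltnS leq_eqVlt => /predU1P[->|/c0].
  by exists i; split=> //; apply: ltnW.
have tm0 : c m * x ^+ m != 0 by rewrite mulf_neq0 ?expf_neq0.
right; case: IHm => [c0|[i [im ci si]]].
  exists m; split=> //; rewrite /s big1 => [|i _]; last by rewrite c0 ?mul0r.
  rewrite add0r divff //; apply/exactP; rewrite ?oner_eq0 // invr1 oppr0.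
  by split; apply: gint1.
have ti0 : c i * x ^+ i != 0 by rewrite mulf_neq0 ?expf_neq0.
have tmi0 := mulf_neq0 tm0 (invr_neq0 ti0).
(* The partial sum stays equivalent to the i-th term in the first case and
   becomes equivalent to the new one in the last; the middle case, where the two
   terms are equivalent, yields a degree for a power of x. *)
have [tm|tm|] := trichotomy 0 tmi0.
- by exists i; split=> //; [apply: ltnW|rewrite mulrDl; apply: exactD].
- case: x_none; have [g cg] := c_exact _ cm0; have [h ch] := c_exact _ ci.
  have [d dE] := Gdiv (m - i)%N (h - g) (eq_ind_r is_true im (subn_gt0 i m)).
  exists d; apply: (@exact_root _ _ (m - i)%N); first by rewrite subn_gt0.
  have -> : x ^+ (m - i) = c m * x ^+ m / (c i * x ^+ i) * (c i / c m).
    have -> : x ^+ m = x ^+ (m - i) * x ^+ i by rewrite -exprD subnK // ltnW.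
    by field; rewrite cm0 ci expf_neq0.
  rewrite dE -[h - g]add0r; apply: exactM tm (exactM ch (exactV cg)).
rewrite oppr0 invf_div => tm; exists m; split=> //.
rewrite mulrDl divff // addrC; apply: exactD.
  apply/exactP; rewrite ?oner_eq0 // invr1 oppr0; split; exact: gint1.
have -> : s / (c m * x ^+ m) = s / (c i * x ^+ i) * (c i * x ^+ i / (c m * x ^+ m)).
  by rewrite mulrA divfK.
by rewrite -[0]addr0; apply: gidM tm; case: si.
Qed.

Section Valuation.
Hypothesis gid1 : forall g, g < 0 -> gid P 1 g.
Hypothesis exact_total : forall x, x != 0 -> exists g, exact_degree P x g.

Let gint_lt x g h : h < g -> gint P x g -> gid P x h.
Proof.
move=> hg xP; rewrite -[x]mul1r -[h](subrK g); apply: gidMr => //.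
by apply: gid1; rewrite -(ltD2l g) addr0 addrC subrK.
Qed.

Lemma gint_exact x g h : exact_degree P x g -> gint P x h <-> h <= g.
Proof.
move=> [xP xN]; split=> [xh|]; first by rewrite leNgt; apply/negP => /gint_lt/(_ xh).
by rewrite le_eqVlt => /predU1P[->//|/gint_lt/(_ xP)/gid_int].
Qed.

Lemma gid_exact x g h : exact_degree P x g -> gid P x h <-> h < g.
Proof.
move=> xg; split=> [xh|/gint_lt]; last by apply; case: xg.
rewrite lt_neqAle; apply/andP; split; last exact/(gint_exact _ xg)/gid_int.
by apply/eqP => hg; case: xg => _; rewrite -hg.
Qed.

Lemma pair_valuation : exists w : valuation L G, forall x g,
  w x = Fin g <-> exact_degree P x g.
Proof.
pose R x (v : withInf G) := if v is Some g then exact_degree P x g else x = 0.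
have [w wP] : {w : L -> withInf G & forall x, R x (w x)}.
  apply: boolp.choice => x.
  have [->|/exact_total[g xg]] := eqVneq x 0; first by exists Inf.
  by exists (Fin g).
have wE x g : exact_degree P x g -> w x = Fin g.
  move=> xg; move: (wP x); rewrite /R; case: (w x) => [h xh|x0].
    have [/(gint_exact _ xh) gh /(gint_exact _ xg) hg] := (proj1 xg, proj1 xh).
    by congr Some; apply/le_anti/andP.
  by have /eqP := exact_neq0 xg.
have w0 : w 0 = Inf.
  by move: (wP 0); rewrite /R; case: (w 0) => // g /exact_neq0; rewrite eqxx.
have wM a c : w (a * c) = w a + w c.
  have := wP a; have := wP c; rewrite {1 2}/R.
  case ca: (w a) => [g|]; case cc: (w c) => [h|] => aP cP.
  + exact/wE/exactM.
  + by rewrite aP mulr0 w0.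
  + by rewrite cP mul0r w0.
  + by rewrite cP mul0r w0.
have wD a c : Order.min (w a) (w c) <= w (a + c).
  have := wP a; have := wP c; rewrite {1 2}/R.
  case ca: (w a) => [g|]; case cc: (w c) => [h|] => aP cP.
  + have := wP (a + c); rewrite {1}/R; case: (w (a + c)) => [k acP|_]; last exact: leInf.
    wlog gh : g h a c {ca cc} aP cP acP / g <= h => [wl|].
      case: (leP g h) => [gh|/ltW hg]; first exact: (wl _ _ _ _ aP cP).
      by rewrite minC; apply: (wl _ _ _ _ cP aP) => //; rewrite addrC.
    rewrite ge_min !leFin; apply/orP; left; apply/(gint_exact _ acP)/gintD.
      by case: cP.
    exact/(gint_exact _ aP).
  + by rewrite aP addr0 ca ge_min lexx.
  + by rewrite cP add0r cc ge_min lexx orbT.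
  + by rewrite cP aP addr0 w0 leInf.
have w1 : w 1 = 0.
  by apply: wE; apply/exactP; rewrite ?oner_eq0 // invr1 oppr0; split; apply: gint1.
exists (Valuation wM wD w1 w0) => x g /=; split=> [wx|]; last exact: wE.
by have := wP x; rewrite /R wx.
Qed.
End Valuation.
End Dichotomy.
End GradedPairs.

(** * The field K[x]/(F) *)

Lemma residue_field (K : fieldType) (F : {poly K}) :
  F \is monic -> irreducible_poly F ->
  exists (L : fieldType) (pi : {rmorphism {poly K} -> L}),
    (forall f, pi f = 0 <-> F %| f) /\
    (forall y, algebraicOver (pi \o polyC) y).
Proof.
move=> Fm Fi; pose mi : monic_irreducible_poly F := (Fi, Fm).
pose L : fieldType := {poly %/ F with mi}.
pose pi : {rmorphism {poly K} -> L} := in_qpoly F.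
have FE : mk_monic F = F := mk_monicE mi.
have pi_onto y : exists f, pi f = y.
  by exists (val (y : {poly %/ F})); apply/val_inj/in_qpoly_small/size_mk_monic.
have piE f : val (pi f) = Pdiv.Ring.rmodp f F by rewrite /= FE.
have piP f : pi f = 0 <-> F %| f.
  rewrite Pdiv.Idomain.dvdpE; split=> [/(congr1 val)|/eqP f0].
    by rewrite piE => f0; apply/eqP.
  by apply: val_inj; rewrite piE.
exists L, pi; split=> // y; have [f <-] := pi_onto y.
have algX : algebraicOver (pi \o polyC) (pi 'X).
  exists F; first exact: monic_neq0.
  have evF g : (map_poly (pi \o polyC) g).[pi 'X] = pi g.
    elim/poly_ind: g => [|g c IHg]; first by rewrite !rmorph0 horner0.
    rewrite rmorphD rmorphM /= map_polyX map_polyC hornerMXaddC IHg.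
    by rewrite rmorphD rmorphM.
  by apply/rootP; rewrite evF; apply/piP/dvdpp.
elim/poly_ind: f => [|g c IHg]; first by rewrite rmorph0; apply: algebraic0.
rewrite rmorphD rmorphM; apply: algebraic_add; first exact: algebraic_mul.
exact: algebraic_id.
Qed.

(** * Initial forms *)

Section GradedClasses.
Context (R : comNzRingType) (G : orderedZmodType) (nu : valuation R G).
Implicit Types (a b : R) (g h : G).

Lemma gr_class_eq g a b (ga : Fin g <= nu a) (gb : Fin g <= nu b) :
  Fin g < nu (a - b) -> gr_class ga = gr_class gb.
Proof.
move=> ab; apply/eqP; rewrite -Quotient.idealrBE; apply/reesIdealP => h /=.
rewrite mcoeffB !mcoeffU; case: eqP => [<-|_] //.
by rewrite subrr valu0 ltInf.
Qed.

Lemma gr_classD g a b (ga : Fin g <= nu a) (gb : Fin g <= nu b)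
    (gab : Fin g <= nu (a + b)) : gr_class gab = gr_class ga + gr_class gb.
Proof.
rewrite /gr_class -rmorphD; congr (\pi _)%qT.
by apply: val_inj; rewrite /= monalgUD.
Qed.

Lemma gr_classM g h a b (ga : Fin g <= nu a) (hb : Fin h <= nu b)
    (gab : Fin (g + h) <= nu (a * b)) : gr_class gab = gr_class ga * gr_class hb.
Proof.
rewrite /gr_class -rmorphM; congr (\pi _)%qT.
by apply: val_inj; rewrite /= -galg_mulUU.
Qed.

Lemma initial_inf a : nu a = Inf -> initial nu a = 0.
Proof.
move=> a_inf; rewrite /initial.
have aux x (e : nu a = x) : x = Inf ->
    match x as x' return nu a = x' -> graded nu with
    | Some g => fun e => gr_class (val_fin_subproof e)
    | None => fun _ => 0 end e = 0 by case: x e.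
exact: aux.
Qed.

Lemma initial_fin a g (ga : Fin g <= nu a) : nu a = Fin g ->
  initial nu a = gr_class ga.
Proof.
move=> a_g; rewrite /initial.
have aux x (e : nu a = x) : x = Fin g ->
    match x as x' return nu a = x' -> graded nu with
    | Some g => fun e => gr_class (val_fin_subproof e)
    | None => fun _ => 0 end e = gr_class ga.
  by case: x e => // h e [hg]; subst h; apply: gr_class_eq; rewrite subrr valu0 ltInf.
exact: aux.
Qed.

(** Also for [nu b] infinite, where both sides vanish. *)
Lemma initial_dvd_class g a b (gab : Fin g <= nu (a * b)) :
  ring_dvd (initial nu b) (gr_class gab).
Proof.
case b_h: (nu b) => [h|]; last first.
  have g0 : Fin g <= nu 0 by rewrite valu0 leInf.
  exists 0; rewrite mul0r -(_ : gr_class g0 = 0).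
    by apply: gr_class_eq; rewrite subr0 valuM b_h addrC ltInf.
  apply: (addrI (gr_class g0)); rewrite -gr_classD ?addr0 // => ?.
  by apply: gr_class_eq; rewrite subrr valu0 ltInf.
have gha : Fin (g - h) <= nu a.
  move: gab; rewrite valuM b_h; case: (nu a) => // a'.
  by rewrite -FinD !leFin -(leD2l (- h)) addrC [- h + _]addrC addrK.
have hb : Fin h <= nu b by rewrite b_h.
exists (gr_class gha); rewrite (initial_fin hb) //.
have gab' : Fin (g - h + h) <= nu (a * b) by rewrite subrK.
rewrite -(gr_classM gha hb gab').
by move: gab'; rewrite subrK => gab'; apply: gr_class_eq; rewrite subrr valu0 ltInf.
Qed.
End GradedClasses.

Lemma ring_dvd_trans (R : comNzRingType) (a b c : R) :
  ring_dvd a b -> ring_dvd b c -> ring_dvd a c.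
Proof. by move=> [d ->] [e ->]; exists (e * d); rewrite mulrA. Qed.

Lemma ring_dvdD (R : comNzRingType) (a b c : R) :
  ring_dvd a b -> ring_dvd a c -> ring_dvd a (b + c).
Proof. by move=> [d ->] [e ->]; exists (d + e); rewrite mulrDl. Qed.

(** In degree 0 of the graded ring the relation would become
    [1 = in(k Q) + in(h F)], a multiple of [in(Q)]. *)
Lemma no_unit_combination (R : comNzRingType) (G : orderedZmodType)
    (nu : valuation R G) (Q F f k h : R) :
  ~ ring_unit (initial nu Q) -> ring_dvd (initial nu Q) (initial nu F) ->
  Fin 0 < nu f -> Fin 0 <= nu (k * Q) -> f + k * Q + h * F <> 1.
Proof.
move=> nunit QF f0 kQ0 sum1; apply: nunit.
have hF0 : Fin 0 <= nu (h * F).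
  (* [h F] is controlled by the relation itself, without a bound on [h]. *)
  have -> : h * F = 1 - f - k * Q by rewrite -sum1; ring.
  apply: valu_geD; rewrite ?valuN //; apply: valu_geD; rewrite ?valuN ?(ltW f0) //.
  by rewrite valu1.
have s0 : Fin 0 <= nu (k * Q + h * F) by apply: valu_geD.
have one0 : Fin 0 <= nu 1 by rewrite valu1.
suff [c /esym cQ] : ring_dvd (initial nu Q) 1 by exists c.
have <- : gr_class s0 = 1.
  transitivity (gr_class one0); last first.
    by rewrite /gr_class (_ : Rees _ = 1) ?rmorph1 //; apply: val_inj.
  apply: gr_class_eq; have -> : k * Q + h * F - 1 = - f by rewrite -sum1; ring.
  by rewrite valuN.
rewrite (gr_classD kQ0 hF0).
by apply: ring_dvdD; [|apply: ring_dvd_trans QF _]; apply: initial_dvd_class.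
Qed.

(** * Extending the valuation along a divisor of in(F) *)

Section Residue.
Context (K : fieldType) (G : orderedZmodType) (nu0 : valuation K G).
Context (nu : extension nu0) (F Q : {poly K}) (L : fieldType).
Context (pi : {rmorphism {poly K} -> L}).
Hypothesis pi0 : forall f, pi f = 0 <-> F %| f.
Hypothesis Q_nunit : ~ ring_unit (initial nu Q).
Hypothesis Q_dvd_F : ring_dvd (initial nu Q) (initial nu F).

(** The image in [L[t^G]] of the Rees ring of [nu], and its ideal generated by
    the elements of larger value and [Q t^(nu Q)]. *)
Definition res_int (a : L) (g : G) := exists2 f, pi f = a & Fin g <= nu f.
Definition res_id (a : L) (g : G) :=
  exists f k, [/\ pi (f + k * Q) = a, Fin g < nu f & Fin g <= nu (k * Q)].

Lemma residue_pair_exists : exists P : graded_pair L G,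
  gint P = res_int /\ gid P = res_id.
Proof.
have i0 g : res_int 0 g by exists 0; rewrite ?rmorph0 // valu0 leInf.
have i1 : res_int 1 0 by exists 1; rewrite ?rmorph1 // valu1.
have iB a b g : res_int a g -> res_int b g -> res_int (a - b) g.
  move=> [f <- fg] [h <- hg]; exists (f - h); first by rewrite rmorphB.
  by apply: valu_geD; rewrite ?valuN.
have iM a b g h : res_int a g -> res_int b h -> res_int (a * b) (g + h).
  move=> [f <- fg] [f' <- f'h]; exists (f * f'); first by rewrite rmorphM.
  by rewrite valuM FinD le_infD.
have d0 g : res_id 0 g.
  by exists 0, 0; rewrite mul0r addr0 rmorph0 valu0 ltInf leInf.
have dD a b g : res_id a g -> res_id b g -> res_id (a + b) g.
  move=> [f [k [<- fg kg]]] [f' [k' [<- f'g k'g]]]; exists (f + f'), (k + k').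
  rewrite mulrDl addrACA rmorphD; split=> //; first exact: valu_gtD.
  exact: valu_geD.
have dM a b g h : res_int a g -> res_id b h -> res_id (a * b) (g + h).
  move=> [f' <- f'g] [f [k [<- fh kh]]]; exists (f' * f), (f' * k).
  rewrite -mulrA -mulrDr rmorphM !(valuM nu f'); split=> //.
    exact: lt_le_infD.
  by rewrite FinD le_infD.
have di a g : res_id a g -> res_int a g.
  by move=> [f [k [<- fg kg]]]; exists (f + k * Q) => //; apply/valu_geD/kg/ltW.
have dP : ~ res_id 1 0.
  move=> [f [k [pi1 f0 k0]]].
  have /pi0/dvdpP[h hE] : pi (1 - (f + k * Q)) = 0 by rewrite rmorphB rmorph1 pi1 subrr.
  by apply: (no_unit_combination (h := h) Q_nunit Q_dvd_F f0 k0); rewrite -hE addrC subrK.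
by exists (GradedPair i0 i1 iB iM d0 dD dM di dP).
Qed.
End Residue.

Lemma valuation_fin (K : fieldType) (G : orderedZmodType) (nu : valuation K G) c :
  c != 0 -> exists g, nu c = Fin g.
Proof.
move=> c0; have := valu1 nu; rewrite -(divff c0) valuM.
by case: (nu c) => // g _; exists g.
Qed.

(** The valuation of [L] comes from a maximal pair above the pair of
    [residue_pair_exists]: the ring of that pair forces [nu <= mu], and the
    element [Q t^(nu Q)] of its ideal forces [nu Q < mu Q]. *)
Lemma extension_over_factor (Gamma : orderedZmodType) (K : fieldType)
    (nu0 : valuation K Gamma) (F Q : {poly K}) (nu : extension nu0) :
  divisible Gamma -> F \is monic -> irreducible_poly F ->
  (forall f, nu f = Inf -> F %| f) ->
  ~ ring_unit (initial nu Q) -> ring_dvd (initial nu Q) (initial nu F) ->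
  nu Q < Inf ->
  exists mu : extension nu0,
    [/\ in_tree_inf F (Ext mu), tree_le (Ext nu) (Ext mu) & nu Q < mu Q].
Proof.
move=> Gdiv Fm Fi suppF Qnu QF.
case Qq: (nu Q) => [q|] // _.
have [L [pi [pi0 pi_alg]]] := residue_field Fm Fi.
have [P0 [P0i P0d]] := residue_pair_exists pi0 Qnu QF.
have [P [leI leD] maxP] := maximal_pair_above P0.
have dich x g := @maximal_dichotomy _ _ P x g maxP.
have intP f g : Fin g <= nu f -> gint P (pi f) g.
  by move=> fg; apply: leI; rewrite P0i; exists f.
have idQ : gid P (pi Q) q.
  by apply: leD; rewrite P0d; exists 0, 1; rewrite mul1r add0r Qq valu0 ltInf.
have id1 g : g < 0 -> gid P 1 g.
  move=> g0; apply: leD; rewrite P0d; exists 1, 0.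
  by rewrite mul0r addr0 rmorph1 valu0 valu1 leInf ltFin.
have iota_eq0 c : (pi c%:P == 0) = (c == 0) := fmorph_eq0 (pi \o polyC) c.
have iotaV c : (pi c%:P)^-1 = pi c^-1%:P by rewrite [RHS](fmorphV (pi \o polyC)).
have exactK c g : nu0 c = Fin g -> exact_degree P (pi c%:P) g.
  move=> cg; have c0 : c != 0 by apply/eqP => c0; rewrite c0 valu0 in cg.
  apply/exactP => //; first by rewrite iota_eq0.
  have cV : nu0 c^-1 = Fin (- g).
    have := valu1 nu0; rewrite -(divff c0) valuM cg.
    by case: (nu0 c^-1) => // h [] /eqP; rewrite addrC addr_eq0 => /eqP->.
  split; first by apply: intP; rewrite ext_extends cg.
  by rewrite iotaV; apply: intP; rewrite ext_extends cV.
have exact_total x : x != 0 -> exists g, exact_degree P x g.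
  move=> x0; have [p p0 /rootP px] := pi_alg x.
  apply: (algebraic_exact dich (c := fun i => pi (p`_i)%:P) (n := size p) Gdiv _ x0).
  - move=> i; rewrite iota_eq0 => /(valuation_fin nu0)[g pg].
    by exists g; apply: exactK.
  - rewrite -[RHS]px horner_coef size_map_poly; apply: eq_bigr => i _.
    by rewrite coef_map.
  - exists (size p).-1; first by rewrite prednK // size_poly_gt0.
    by rewrite iota_eq0 -lead_coefE lead_coef_eq0.
have [w wP] := pair_valuation dich id1 exact_total.
have w_inf x : w x = Inf <-> x = 0.
  split=> [wx|->]; last exact: valu0.
  by apply: contrapT => /eqP/exact_total[g /wP]; rewrite wx.
have muM f h : w (pi (f * h)) = w (pi f) + w (pi h) by rewrite rmorphM valuM.
have muD f h : Order.min (w (pi f)) (w (pi h)) <= w (pi (f + h)).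
  by rewrite rmorphD; apply: valuD.
have mu1 : w (pi 1) = 0 by rewrite rmorph1 valu1.
have mu0 : w (pi 0) = Inf by rewrite rmorph0 valu0.
pose mu := Valuation muM muD mu1 mu0.
have mu_ext c : mu c%:P = nu0 c.
  have [->|/(valuation_fin nu0)[g cg]] := eqVneq c 0; first by rewrite !valu0.
  by rewrite cg; apply/wP/exactK.
exists (Extension mu_ext); split.
- by move=> f; split=> [/w_inf/pi0|/pi0/w_inf].
- move=> f /=; case fg: (nu f) => [g|]; last first.
    by have -> : w (pi f) = Inf by apply/w_inf/pi0/suppF.
  case wf: (w (pi f)) => [h|]; last exact: leInf.
  by rewrite leFin; apply/(gint_exact id1 g (iffLR (wP _ _) wf))/intP; rewrite fg lexx.
rewrite /=; case wQ: (w (pi Q)) => [h|]; last exact: ltInf.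
by rewrite ltFin; apply/(gid_exact id1 q (iffLR (wP _ _) wQ)).
Qed.

(** * Stability at the leaves *)

(** A valuation of support [(F)] is one of the field [K[x]/(F)], where the
    inequalities for an element and for its inverse force equality. *)
Lemma leaf_maximal (Gamma : orderedZmodType) (K : fieldType)
    (nu0 : valuation K Gamma) (F : {poly K}) (mu mu' : extension nu0) :
  irreducible_poly F -> in_tree_inf F (Ext mu) -> tree_le (Ext mu) (Ext mu') ->
  forall f, mu' f = mu f.
Proof.
move=> Fi suppF le f.
have inf_le x : Inf <= x -> x = Inf :> withInf Gamma by case: x.
have [Ff|nFf] := boolP (F %| f).
  have mf : mu f = Inf by apply/suppF.
  by rewrite mf; apply: inf_le; rewrite -mf; apply: le.
have [F1 _] := Fi.
have : coprimep F f by rewrite irreducible_poly_coprime.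
move=> /Bezout_eq1_coprimepP[[u v] /= uv].
have val_vf (w : extension nu0) : w F = Inf -> w v + w f = 0.
  move=> wF; have wuF : w (u * F) = Inf by rewrite valuM wF addrC.
  rewrite -valuM; apply/le_anti/andP; split.
    rewrite -(valu1 w) -uv; apply: valu_geD => //.
    by rewrite wuF leInf.
  have -> : v * f = 1 - u * F by rewrite -uv; ring.
  by apply: valu_geD; rewrite ?valu1 ?valuN ?wuF ?leInf.
have muF : mu F = Inf by apply/suppF/dvdpp.
have mu'F : mu' F = Inf by apply: inf_le; rewrite -muF; apply: le.
have := val_vf _ muF; have := val_vf _ mu'F; have := le v; have := le f.
case: (mu f) => [a|]; case: (mu' f) => [a'|]; case: (mu v) => [b|] //;
  case: (mu' v) => [b'|] //.
rewrite !leFin => aa bb [e'] [e]; congr Some; apply/le_anti; rewrite aa andbT.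
by rewrite -(leD2l b') e' -e [b + a]addrC [b' + a]addrC leD2l.
Qed.

(* For Q = F every mu in V_F lies below some mu' in V_F of support (F), where  *)
(* mu' Q = oo, so alpha1 = oo is then the only possible stable value.          *)
Theorem theorem1p5 (Gamma : orderedZmodType) (Gamma_div : divisible Gamma)
  (K : fieldType) (nu0 : valuation K Gamma)
  (F : {poly K}) (F_monic : F \is monic) (F_irr : irreducible_poly F)
  (nu : extension nu0) (nu_F : in_tree F (Ext nu))
  (nu_nmax : ~ maximal (Ext nu))
  (phi : graded nu) (phi_hom : homogeneous phi)
  (phi_irr : ring_irreducible phi) (phi_dvd : ring_dvd phi (initial nu F))
  (u : graded nu) (u_unit : ring_unit u)
  (Q : {poly K}) (Q_key : key_poly nu Q) (phi_eq : phi = u * initial nu Q) :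
  exists (alpha1 : withInf Gamma) (mu : extension nu0),
    [/\ Q <> F -> exists g : Gamma, alpha1 = Fin g,
        in_tree F (Ext mu),
        nu Q < alpha1,
        mu Q = alpha1 &
        forall mu' : extension nu0, in_tree F (Ext mu') ->
          tree_le (Ext mu) (Ext mu') -> mu' Q = alpha1].
Proof.
case: Q_key => Q_monic [Q_nz Q_nu _] Q_min.
have Q_dvd : ring_dvd (initial nu Q) (initial nu F).
  apply: ring_dvd_trans phi_dvd; exists u; exact: phi_eq.
have [[//|mu0] mu0_supp le_mu0] := nu_F.
have nuQ : nu Q < Inf.
  by case e: (nu Q) => [q|]; [apply: ltInf|case: Q_nz; apply: initial_inf].
have leaf_in_tree (mu : extension nu0) : in_tree_inf F (Ext mu) -> in_tree F (Ext mu).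
  by move=> mu_supp; exists (Ext mu).
have stable (mu : extension nu0) : in_tree_inf F (Ext mu) -> forall mu' : extension nu0,
    in_tree F (Ext mu') -> tree_le (Ext mu) (Ext mu') -> mu' Q = mu Q.
  by move=> mu_supp mu' _ le; apply: (leaf_maximal F_irr mu_supp).
have [QF|QF] := pselect (Q = F).
  have mu0Q : mu0 Q = Inf by apply/mu0_supp; rewrite QF.
  exists Inf, mu0; split=> //; first exact: leaf_in_tree.
  by rewrite -mu0Q; apply: stable.
have suppF f : nu f = Inf -> F %| f.
  move=> nuf; apply/mu0_supp; have := le_mu0 f; rewrite nuf.
  by rewrite /Defs.support; case: (mu0 f).
have [mu [mu_supp le_mu mu_Q]] :=
  extension_over_factor Gamma_div F_monic F_irr suppF Q_nu Q_dvd nuQ.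
exists (mu Q), mu; split=> //; [|exact: leaf_in_tree|exact: stable].
move=> _; case muQ: (mu Q) => [g|]; first by exists g.
case: QF; have /mu_supp FQ := muQ.
have szQF : (size Q <= size F)%N by apply: Q_min => //; apply: monic_neq0.
apply/eqP; rewrite eq_sym -eqp_monic // -dvdp_size_eqp //.
by rewrite eqn_leq szQF dvdp_leq // monic_neq0.
Qed.
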